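(* Let $K$ be a field, $S=K[x_1,\ldots,x_n]$ the polynomial ring, and $I\subset S$ a monomial ideal. The following conditions are equivalent: (a) $I$ is polymatroidal. (b) $I:u$ is polymatroidal for all monomials $u\in S$. (c) For all monomials $u\in S$, the ideal $I:u$ is generated in a single degree and has linear quotients with respect to the reverse lexicographic order of its minimal monomial generators. (d) $I:u$ has a linear resolution for all monomials $u\in S$. (e) $I:u$ is generated in a single degree for all monomials $u\in S$.
   Context: For a monomial ideal $I$, $G(I)$ denotes its unique minimal set of monomial generators, and $\deg_{x_i}(u)$ is the exponent of $x_i$ in the monomial $u$. $I$ is ''generated in a single degree'' if all elements of $G(I)$ have the same degree. A monomial ideal $I$ is polymatroidal if it is generated in a single degree and, for all $u,v\in G(I)$ and every $i$ with $\deg_{x_i}(u)>\deg_{x_i}(v)$, there exists $j$ with $\deg_{x_j}(u)<\deg_{x_j}(v)$ such that $x_j(u/x_i)\in I$. A monomial ideal $L$ has linear quotients with respect to an ordering $u_1,\ldots,u_m$ of $G(L)$ if for each $i=2,\ldots,m$ the colon ideal $(u_1,\ldots,u_{i-1}):u_i$ is generated by a subset of the variables. For the reverse lexicographic order, the generators are listed in decreasing order $u_1>u_2>\cdots>u_m$ with respect to the reverse lexicographic order induced by $x_1>\cdots>x_n$. A graded ideal $L$ has a linear resolution if for some $d$ it has a $d$-linear resolution, i.e. $\mathrm{Tor}_i^S(L,K)_j=0$ for all $i$ and all $j\neq i+d$ (in particular $L$ is generated in degree $d$). *)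

(* Defs.v *)
From HB Require Import structures.
From mathcomp Require Import all_boot all_order all_algebra.
From mathcomp Require Import mpoly.

Set Implicit Arguments.
Unset Strict Implicit.
Unset Printing Implicit Defensive.

Import GRing.Theory.
Local Open Scope ring_scope.

(* Variables are numbered from 0: x_1, ..., x_n are 'X_0, ..., 'X_(n-1).
   Ideals are Prop-valued predicates on {mpoly K[n]}; the zero ideal and the
   unit ideal are allowed. *)

Section MonomialIdeals.
Context {K : fieldType} {n : nat}.
Local Notation S := {mpoly K[n]}.
Local Notation mon := 'X_{1..n}.

Definition same_set (A B : S -> Prop) : Prop := forall f, A f <-> B f.

Definition is_ideal (I : S -> Prop) : Prop :=
  [/\ I 0, forall f g, I f -> I g -> I (f + g) & forall f g, I g -> I (f * g)].

Definition ideal_gen (A : S -> Prop) : S -> Prop := fun f =>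
  forall J : S -> Prop, is_ideal J -> (forall g, A g -> J g) -> J f.

Definition mono_ideal (A : mon -> Prop) : S -> Prop :=
  ideal_gen (fun f => exists2 m, A m & f = 'X_[m]).

Definition monomial_ideal (I : S -> Prop) : Prop :=
  exists A : mon -> Prop, same_set I (mono_ideal A).

Definition min_mono_gens (I : S -> Prop) (G : mon -> Prop) : Prop :=
  same_set I (mono_ideal G) /\
  forall H : mon -> Prop, (forall m, H m -> G m) ->
    same_set I (mono_ideal H) -> forall m, G m -> H m.

(* G(I).  A monomial ideal has exactly one minimal set of monomial
   generators, so the existential only names it. *)
Definition mingen (I : S -> Prop) : mon -> Prop := fun m =>
  exists2 G, min_mono_gens I G & G m.

Definition single_degree (I : S -> Prop) : Prop :=
  forall u v, mingen I u -> mingen I v -> mdeg u = mdeg v.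

Definition polymatroidal (I : S -> Prop) : Prop :=
  [/\ monomial_ideal I,
      single_degree I
    & forall u v, mingen I u -> mingen I v ->
      forall i : 'I_n, (v i < u i)%N ->
      exists2 j : 'I_n, (u j < v j)%N & I 'X_[u - U_(i) + U_(j)]].

Definition colon (I : S -> Prop) (g : S) : S -> Prop := fun f => I (f * g).

(* u > v in the (degree) reverse lexicographic order with x_1 > ... > x_n: at
   equal degrees, the last exponent where u and v differ is smaller in u.  The
   order that mpoly puts on 'X_{1..n} is degree-lexicographic instead. *)
Definition revlex_gt : rel mon := fun u v =>
  (mdeg v < mdeg u)%N ||
  (mdeg u == mdeg v) &&
  [exists i : 'I_n,
    (u i < v i)%N && [forall k : 'I_n, (i < k)%N ==> (u k == v k)]].

Definition generated_by_variables (I : S -> Prop) : Prop :=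
  exists A : {set 'I_n},
    same_set I (ideal_gen (fun f => exists2 i, i \in A & f = 'X_i)).

Definition linear_quotients_wrt (s : seq mon) : Prop :=
  forall i, (0 < i < size s)%N ->
  generated_by_variables
    (colon (mono_ideal (fun m => m \in take i s)) 'X_[nth 0%MM s i]).

Definition revlex_linear_quotients (L : S -> Prop) : Prop :=
  exists s : seq mon,
    [/\ forall m, m \in s <-> mingen L m,
        sorted revlex_gt s
      & linear_quotients_wrt s].

End MonomialIdeals.

Section LinearResolutions.
Context {K : fieldType} {n : nat}.
Local Notation S := {mpoly K[n]}.

(* The data of a complex ... -> F_1 -> F_0 -> S, where F_i is the free module
   of row vectors of length fc_rank i whose k-th basis vector has degree
   fc_deg i k.  Maps act on row vectors by right multiplication. *)
Record free_complex := FreeComplex {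
  fc_rank : nat -> nat;
  fc_deg : forall i, 'I_(fc_rank i) -> nat;
  fc_diff : forall i, 'M[S]_(fc_rank i.+1, fc_rank i);
  fc_aug : 'cV[S]_(fc_rank 0)
}.
Arguments fc_deg : clear implicits.

(* All maps are homogeneous of degree 0. *)
Definition graded_complex (F : free_complex) : Prop :=
  (forall k, fc_aug F k 0 \is (fc_deg F 0 k).-homog) /\
  (forall i k l m, m \in msupp (fc_diff F i k l) ->
     (mdeg m + fc_deg F i l = fc_deg F i.+1 k)%N).

(* ... -> F_1 -> F_0 -> L -> 0 is exact.  Since L lies in nonnegative degrees
   and S is Noetherian, finite ranks and shifts in nat are enough for L to have
   such a resolution. *)
Definition graded_free_resolution (L : S -> Prop) (F : free_complex) : Prop :=
  [/\ graded_complex F,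
      forall f, L f <-> exists v : 'rV_(fc_rank F 0), v *m fc_aug F = f%:M,
      forall v : 'rV_(fc_rank F 0),
        v *m fc_aug F = 0 <-> exists w, v = w *m fc_diff F 0
    & forall i (v : 'rV_(fc_rank F i.+1)),
      v *m fc_diff F i = 0 <-> exists w, v = w *m fc_diff F i.+1].

(* The differential of F (x)_S K, where K = S/(x_1, ..., x_n): reduction modulo
   the variables keeps the constant coefficients only. *)
Definition diff_tensor_K (F : free_complex) (i : nat) :
    'M[K]_(fc_rank F i.+1, fc_rank F i) :=
  map_mx (mcoeff 0%MM) (fc_diff F i).

(* v lies in the degree j component of F_i (x)_S K. *)
Definition in_degree (F : free_complex) (i j : nat)
    (v : 'rV[K]_(fc_rank F i)) : Prop :=
  forall k, v 0 k != 0 -> fc_deg F i k = j.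

Definition cycle_tensor_K (F : free_complex) (i : nat) :
    'rV[K]_(fc_rank F i) -> Prop :=
  match i with
  | 0 => fun=> True
  | i'.+1 => fun v => v *m diff_tensor_K F i' = 0
  end.

(* H_i(F (x)_S K)_j = 0 *)
Definition homology_tensor_K_zero (F : free_complex) (i j : nat) : Prop :=
  forall v : 'rV[K]_(fc_rank F i), in_degree j v -> cycle_tensor_K v ->
  exists2 w : 'rV[K]_(fc_rank F i.+1),
    in_degree j w & v = w *m diff_tensor_K F i.

(* Tor_i^S(L, K)_j = 0, with Tor computed from a graded free resolution of L;
   the choice of resolution is immaterial, since any two are homotopy
   equivalent. *)
Definition Tor_zero (L : S -> Prop) (i j : nat) : Prop :=
  exists2 F, graded_free_resolution L F & homology_tensor_K_zero F i j.

Definition has_linear_resolution (L : S -> Prop) : Prop :=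
  exists d : nat, forall i j : nat, j <> (i + d)%N -> Tor_zero L i j.

End LinearResolutions.

Arguments fc_deg {K n} f i _.

(* Main.v *)
Require Import Defs.
From mathcomp Require Import all_boot all_order all_algebra.
From mathcomp Require Import mpoly zify.
From Stdlib Require Import ClassicalEpsilon.

Set Implicit Arguments.
Unset Strict Implicit.
Unset Printing Implicit Defensive.

(** The theorem is proved along the cycle
    (a) => (b) => (c) => (d) => (e) => (a).

    (e) => (a).  Given generators u, v of I with u_i > v_i, put w = u / x_i.
    The colon ideal I : w contains x_i but not 1, because u is a minimal
    generator; being generated in a single degree, it is generated by
    variables.  It also contains v / gcd(v, w), which is therefore divisible
    by a variable x_j of I : w, and this j is the one that the exchange
    property asks for ([single_degree_colons_polymatroidal]).

    (a) => (b).  Since (I : u) : v = I : uv, the implication (e) => (a) applied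
    to I : u reduces the claim to: every colon ideal I : u of a polymatroidal
    ideal is generated in a single degree.  The divisors of the generators of I
    form a discrete polymatroid, in which a vector can be augmented towards any
    longer one ([augmentation]).  If a generator g of I meets u in a vector
    that is not as long as possible, augmenting that vector and extending it
    again to a basis inside the join with g produces a generator g' whose
    g' / gcd(g', u) divides g / gcd(g, u) properly
    ([colon_degrees_drop]).

    (b) => (c).  If v > u in the reverse lexicographic order, the last exponent
    where they differ is larger in u; exchanging there replaces u by a still
    larger generator x_j (u / x_l), with j < l and x_j dividing v / gcd(v, u)
    ([polymatroidal_revlex_linear_quotients]).

    (c) => (d).  Linear quotients make sense for the rows of any matrix over S,
    and they pass to syzygies.  If row k has colon ideal (x : x in P_k) with
    respect to the previous rows, each x in P_k yields a syzygy
    x e_k - (combination of the previous e_l); ordered by (k, x), these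
    syzygies generate the syzygy module, and again have linear quotients, the
    colon ideal of the syzygy (k, x) being generated by the y < x in P_k
    ([linear_syzygies]).  When the rows are homogeneous of the same degree the
    combination can be taken with linear coefficients, so that iteration,
    started from the column of generators, yields a resolution with linear
    maps ([linear_quotients_linear_resolution]).

    (d) => (e).  This is the part of Nakayama's lemma that reads the degrees of
    the generators off Tor_0 ([linear_resolution_single_degree]). *)

Import GRing.Theory.
Local Open Scope ring_scope.

(** * Divisibility and degrees of monomials *)

Section Multinomials.
Context {n : nat}.
Implicit Types (a b m : 'X_{1..n}).

Lemma mdeg_subm a b : (a <= b)%MM -> mdeg (b - a)%MM = (mdeg b - mdeg a)%N.
Proof. by move=> /submK{2}<-; rewrite mdegD addnK. Qed.

Lemma lepm_mdeg a b : (a <= b)%MM -> (mdeg a <= mdeg b)%N.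
Proof. by move=> /submK<-; rewrite mdegD leq_addl. Qed.

Lemma lepm_mdeg_eq a b : (a <= b)%MM -> (mdeg b <= mdeg a)%N -> a = b.
Proof.
move=> ab deg; have /eqP : mdeg (b - a)%MM = 0%N.
  by rewrite mdeg_subm //; apply/eqP; rewrite subn_eq0.
by rewrite mdeg_eq0 => /eqP ba0; rewrite -(submK ab) ba0 add0m.
Qed.

Lemma mdeg_lt_coord a b : (mdeg a < mdeg b)%N -> exists i, (a i < b i)%N.
Proof.
move=> ab; apply/existsP; apply: contraLR ab => /existsPn ge; rewrite -leqNgt.
by apply/lepm_mdeg/mnm_lepP => i; rewrite leqNgt.
Qed.

Lemma lepm_BLR a b m : (a - b <= m)%MM = (a <= m + b)%MM.
Proof.
by apply/mnm_lepP/mnm_lepP => le i; move: (le i); rewrite mnmBE mnmDE leq_subLR addnC.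
Qed.

End Multinomials.

(** * Monomial ideals and their minimal generators *)

Section Ideals.
Context {K : fieldType} {n : nat}.
Local Notation S := {mpoly K[n]}.
Local Notation mon := 'X_{1..n}.
Implicit Types (I L : S -> Prop) (A : mon -> Prop) (m u v g : mon) (f : S).

Lemma ideal_gen_ideal (A : S -> Prop) : is_ideal (ideal_gen A).
Proof.
split=> [J [] //|f h If Ig J idJ AJ|f h Ig J idJ AJ].
  by have [_ addJ _] := idJ; apply: addJ; [apply: If | apply: Ig].
by have [_ _ mulJ] := idJ; apply: mulJ; apply: Ig.
Qed.

Lemma ideal_sum I (T : eqType) (r : seq T) (F : T -> S) :
  is_ideal I -> (forall t, t \in r -> I (F t)) -> I (\sum_(t <- r) F t).
Proof.
move=> [I0 ID _] IF; rewrite big_seq; elim/big_rec: _ => // t f rt If.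
by apply: ID => //; apply: IF.
Qed.

(** A monomial ideal is spanned by its monomials; every later question about
    membership is reduced by this to divisibility of exponents. *)
Lemma mono_idealP A f :
  mono_ideal A f <-> forall m, m \in msupp f -> exists2 a, A a & (a <= m)%MM.
Proof.
split=> [|supp_f].
  pose J (h : S) := forall m, m \in msupp h -> exists2 a, A a & (a <= m)%MM.
  move=> /(_ J); apply=> [|_ [a Aa ->] m]; last first.
    by move=> /mem_msuppXP<-; exists a => //; apply: lepm_refl.
  split=> [m|f1 h Ig Ih m|f1 h Ih m]; first by rewrite msupp0.
    by move=> /msuppD_le; rewrite mem_cat => /orP[/Ig|/Ih].
  move=> /msuppM_le /allpairsP[[m1 m2] /= [_ /Ih[a Aa am2] ->]].
  by exists a => //; apply: lepm_trans am2 (lem_addl _ _).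
rewrite [f]mpolyE.
apply: ideal_sum; first exact: ideal_gen_ideal.
move=> m /supp_f[a Aa am]; rewrite -(submK am) mpolyXD -mul_mpolyC mulrA => J idJ AJ.
by have [_ _ mulJ] := idJ; apply: mulJ; apply: AJ; exists a.
Qed.

Lemma mono_idealX A m :
  mono_ideal A ('X_[m] : S) <-> exists2 a, A a & (a <= m)%MM.
Proof.
split=> [/mono_idealP/(_ m)|Am].
  by rewrite msuppX inE eqxx => /(_ isT).
by apply/mono_idealP => _ /mem_msuppXP<-.
Qed.

Lemma monomial_idealP I : monomial_ideal I ->
  forall f, I f <-> forall m, m \in msupp f -> I 'X_[m].
Proof.
move=> [A IA] f; split=> [/IA/mono_idealP If m /If ?|If].
  by apply/IA/mono_idealX.
by apply/IA/mono_idealP => m /If/IA/mono_idealX.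
Qed.

Lemma monomial_ideal_le I u v : monomial_ideal I ->
  (u <= v)%MM -> I 'X_[u] -> I 'X_[v].
Proof.
move=> [A IA] uv /IA/mono_idealX[a Aa au].
by apply/IA/mono_idealX; exists a => //; apply: lepm_trans uv.
Qed.

Lemma msupp_mulX f u m :
  m \in msupp (f * 'X_[u]) <-> exists2 m', m' \in msupp f & m = (m' + u)%MM.
Proof.
rewrite (perm_mem (msuppMX f u)); split=> [/mapP[m' fm' ->]|[m' fm' ->]].
  by exists m' => //; rewrite addmC.
by apply/mapP; exists m' => //; rewrite addmC.
Qed.

Lemma monomial_ideal_colon I u :
  monomial_ideal I -> monomial_ideal (colon I 'X_[u]).
Proof.
move=> mI; exists (fun m => I 'X_[m + u]) => f; rewrite /colon monomial_idealP //.
split=> [If|/mono_idealP If _ /msupp_mulX[m fm ->]].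
  apply/mono_idealP => m fm; exists m; last exact: lepm_refl.
  by apply: If; apply/msupp_mulX; exists m.
have [a Ia am] := If m fm; apply: monomial_ideal_le Ia => //.
by apply/mnm_lepP => i; rewrite !mnmDE leq_add2r; apply/mnm_lepP.
Qed.

Lemma colonX I u m : colon I 'X_[u] 'X_[m] = I 'X_[m + u].
Proof. by rewrite /colon -mpolyXD. Qed.

(** Minimality for divisibility, which is easier to use than the minimality of
    generating sets in [mingen] and agrees with it on monomial ideals. *)
Definition minimal_in I m :=
  I 'X_[m] /\ forall m', I 'X_[m'] -> (m' <= m)%MM -> m' = m.

Lemma minimal_below I m :
  I 'X_[m] -> exists2 g, minimal_in I g & (g <= m)%MM.
Proof.
have [d] := ubnP (mdeg m); elim: d m => // d IH m deg_m Im.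
have [min_m|not_min] := classic (minimal_in I m).
  by exists m => //; apply: lepm_refl.
have [m' [Im' le ne]] : exists m', [/\ I 'X_[m'], (m' <= m)%MM & m' <> m].
  apply: NNPP => none; apply: not_min; split=> // m' Im' le.
  by apply: NNPP => ne; apply: none; exists m'.
have [|//|g min_g gm'] := IH m'; last by exists g => //; apply: lepm_trans le.
rewrite ltnS in deg_m; apply: leq_trans deg_m.
by rewrite ltnNge; apply/negP => /(lepm_mdeg_eq le).
Qed.

(** Every generating set contains the divisibility-minimal monomials, and these
    already generate, since divisibility is well founded. *)
Lemma mingenP I : monomial_ideal I -> forall m, mingen I m <-> minimal_in I m.
Proof.
move=> mI m.
have gen (G : mon -> Prop) : (forall g, G g -> I 'X_[g]) ->
    (forall g, minimal_in I g -> G g) -> same_set I (mono_ideal G).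
  move=> GI Gmin f; rewrite (monomial_idealP mI) mono_idealP.
  split=> If k fk; last by have [a /GI Ia /(monomial_ideal_le mI)] := If k fk; apply.
  by have [g /Gmin] := minimal_below (If k fk); exists g.
split=> [[G [IG minG] Gm]|min_m].
  have GI g : G g -> I 'X_[g].
    by move=> Gg; apply/IG/mono_idealX; exists g => //; apply: lepm_refl.
  suff [] : G m /\ minimal_in I m by [].
  apply: (minG (fun g => G g /\ minimal_in I g)) => // [g []//|].
  apply: gen => [g [/GI]|g min_g] //; split=> //.
  have [/IG/mono_idealX[a Ga ag] eq_g] := min_g.
  by rewrite -(eq_g a) //; apply: GI.
rewrite /mingen; exists (minimal_in I); last by [].
split; first by apply: gen => // g; case.
move=> H HI IH k min_k; have [Ik eq_k] := min_k.
have /IH/mono_idealX[h Hh hk] := Ik.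
by rewrite -(eq_k h) //; have [] := HI _ Hh.
Qed.

Lemma mingen_in I m : monomial_ideal I -> mingen I m -> I 'X_[m].
Proof. by move=> mI /(mingenP mI)[]. Qed.

Lemma mingen_below I m : monomial_ideal I ->
  I 'X_[m] -> exists2 g, mingen I g & (g <= m)%MM.
Proof. by move=> mI /minimal_below[g]; exists g => //; apply/mingenP. Qed.

(** A generator dividing such an m has the degree of m, hence equals m.  This
    turns the membership in the exchange property of a polymatroidal ideal into
    an exchange between generators. *)
Lemma mingen_of_mdeg I u m : monomial_ideal I -> single_degree I ->
  mingen I u -> I 'X_[m] -> mdeg m = mdeg u -> mingen I m.
Proof.
move=> mI sI Iu Im deg; have [g Ig gm] := mingen_below mI Im.
by rewrite -(lepm_mdeg_eq gm) // deg (sI u g).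
Qed.

End Ideals.

(** * Exchange and augmentation for bases of a polymatroid *)

Section Bases.
Context {n : nat} (B : 'X_{1..n} -> Prop).
Implicit Types (a b g u : 'X_{1..n}).

(** These two properties say that B is the set of bases of a discrete
    polymatroid; its independent vectors are the divisors of elements of B. *)
Definition equal_degrees := forall u v, B u -> B v -> mdeg u = mdeg v.
Definition exchange := forall u v, B u -> B v ->
  forall i : 'I_n, (v i < u i)%N ->
  exists2 j : 'I_n, (u j < v j)%N & B (u - U_(i) + U_(j))%MM.

Hypothesis degB : equal_degrees.
Hypothesis exB : exchange.

(** If g leaves no room above a at any coordinate where b exceeds a, then,
    degrees being equal, g has more slack over a than h over b at some
    coordinate i; then g_i > a_i >= b_i, and so g_i > h_i.  An exchange at i
    keeps a below the basis and brings it closer to h, so induction on the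
    distance sum_k max(g_k - h_k, 0) concludes. *)
Lemma augmentation g h a b : B g -> B h -> (a <= g)%MM -> (b <= h)%MM ->
  (mdeg a < mdeg b)%N ->
  exists2 j, (a j < b j)%N & exists2 g', B g' & (a + U_(j) <= g')%MM.
Proof.
move=> + Bh + bh ab; have [N] := ubnP (mdeg (g - h)%MM).
elim: N g => // N IH g dist Bg ag.
have [/existsP[j /andP[abj agj]]|/existsPn stuck] :=
  boolP [exists j, (a j < b j)%N && (a j < g j)%N].
  exists j => //; exists g => //; apply/mnm_lepP => k.
  have /mnm_lepP/(_ k) := ag; rewrite mnmDE mnm1E; case: eqP => [<-|_]; lia.
have [i] : exists i, ((h - b)%MM i < (g - a)%MM i)%N.
  apply: mdeg_lt_coord; rewrite !mdeg_subm // (degB Bg Bh).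
  have := lepm_mdeg bh; lia.
have /mnm_lepP/(_ i) := ag; have /mnm_lepP/(_ i) := bh.
move=> bhi agi; rewrite !mnmBE => slack.
have ai_gi : (a i < g i)%N by lia.
have bi_ai : (b i <= a i)%N by have := stuck i; lia.
have hi_gi : (h i < g i)%N by lia.
have [j gj_hj Bg'] := exB Bg Bh hi_gi.
apply: (IH _ _ Bg'); last first.
  apply/mnm_lepP => k; rewrite mnmDE mnmBE !mnm1E.
  have /mnm_lepP/(_ k) := ag; case: (i =P k) => [<-|_]; case: (j == _); lia.
rewrite ltnS in dist; apply: leq_trans dist.
(* The exchange lowers the distance by at least one: a unit is removed above h
   at i and the unit added at j stays below h. *)
have le_dist : (g - U_(i) + U_(j) - h + U_(i) <= g - h)%MM.
  apply/mnm_lepP => k; rewrite !(mnmDE, mnmBE, mnm1E).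
  case: (i =P k) => [<-|_]; case: (j =P _) => [jk|_]; rewrite -?jk; try lia.
  by move: gj_hj; rewrite jk; lia.
by have := lepm_mdeg le_dist; rewrite mdegD mdeg1 addn1.
Qed.

(** Augmenting a repeatedly in the direction of g reaches a basis while never
    leaving the join of a and g. *)
Lemma extend_to_base g h a : B g -> B h -> (a <= h)%MM ->
  exists2 g', B g' & (a <= g')%MM /\ (g' <= mlcm a g)%MM.
Proof.
move=> Bg; have [N] := ubnP (mdeg g - mdeg a).
elim: N h a => // N IH h a ltN Bh ah.
have deg_a := lepm_mdeg ah; rewrite (degB Bh Bg) in deg_a.
have [deg|ne_deg] := eqVneq (mdeg a) (mdeg g).
  exists h => //; split=> //; rewrite (lepm_mdeg_eq ah) ?lem_mlcml //.
  by rewrite deg (degB Bh Bg).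
have [|j ajgj [h' Bh' ah']] := augmentation Bh Bg ah (lepm_refl g); first by lia.
have [|//|//|g' Bg' [ag' g'l]] := IH h' (a + U_(j))%MM.
  by rewrite mdegD mdeg1; lia.
exists g' => //; split; first exact: lepm_trans (lem_addr _ _) ag'.
apply: lepm_trans g'l _; rewrite lem_mlcm lem_mlcmr andbT.
apply/mnm_lepP => k; rewrite mlcmE !(mnmDE, mnmBE, mnm1E).
by case: eqP => [<-|_]; lia.
Qed.

(** In terms of a = gcd(g, u) and b = gcd(h, u) the hypothesis says that a is
    shorter than b.  Augmenting a by some x_j with a_j < b_j <= u_j and
    extending to a basis in the join with g changes g above u only by lowering
    it, and it meets u in a longer vector. *)
Lemma colon_degrees_drop u g h : B g -> B h ->
  (mdeg (h - u)%MM < mdeg (g - u)%MM)%N ->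
  exists2 g', B g' & (g' - u <= g - u)%MM /\ (g' - u)%MM <> (g - u)%MM.
Proof.
move=> Bg Bh lt_deg.
(* With truncated subtraction, m - (m - u) is the gcd of m and u. *)
have meet m : (m - (m - u) <= m)%MM /\ mdeg (m - (m - u))%MM = (mdeg m - mdeg (m - u)%MM)%N.
  by rewrite mdeg_subm ?lem_subr.
have [] := meet g; have [] := meet h; set a := (g - _)%MM; set b := (h - _)%MM.
move=> bh deg_b ag deg_a.
have [|j abj [h' Bh' ah']] := augmentation Bg Bh ag bh.
  have := lepm_mdeg (lem_subr h u); have := lepm_mdeg (lem_subr g u).
  by rewrite deg_a deg_b (degB Bh Bg); lia.
have [g' Bg' [ag' g'le]] := extend_to_base Bg Bh' ah'.
have le : (g' - u <= g - u)%MM.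
  apply/mnm_lepP => k; have /mnm_lepP/(_ k) := g'le; have := abj.
  rewrite mlcmE /a /b !(mnmDE, mnmBE, mnm1E).
  by case: (j =P k) => [<-|_]; lia.
exists g' => //; split=> // eq_colon.
have : (mdeg (g' - (g' - u)) <= mdeg a)%N.
  by rewrite eq_colon mdeg_subm ?deg_a ?(degB Bg' Bg) // -eq_colon lem_subr.
apply/negP; rewrite -ltnNge -addn1 -(mdeg1 j) -mdegD; apply: lepm_mdeg.
apply/mnm_lepP => k; have /mnm_lepP/(_ k) := ag'.
move: abj; rewrite /a /b !(mnmDE, mnmBE, mnm1E).
by case: (j =P k) => [<-|_]; lia.
Qed.

End Bases.

(** * Polymatroidal ideals and the degrees of their colon ideals *)

Section Polymatroidal.
Context {K : fieldType} {n : nat}.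
Local Notation S := {mpoly K[n]}.
Local Notation mon := 'X_{1..n}.
Implicit Types (I L : S -> Prop) (m u v g : mon).

Lemma mdeg_exchange u i j : (0 < u i)%N -> mdeg (u - U_(i) + U_(j))%MM = mdeg u.
Proof.
move=> ui; rewrite mdegD mdeg1 mdeg_subm ?mdeg1; last by rewrite lep1mP -lt0n.
by rewrite subn1 addn1 prednK // (leq_trans ui) // mdegE (bigD1 i) //= leq_addr.
Qed.

Lemma polymatroidal_exchange I : polymatroidal I -> exchange (mingen I).
Proof.
move=> [mI sI exI] u v Iu Iv i vu; have [j uv Iex] := exI u v Iu Iv i vu.
exists j => //; apply: (mingen_of_mdeg mI sI Iu Iex).
by rewrite mdeg_exchange // (leq_trans _ vu).
Qed.

(** The generators of I : u are among the g / gcd(g, u) with g a generator of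
    I, and by [colon_degrees_drop] only those of least degree are minimal. *)
Lemma polymatroidal_colon_single_degree I u :
  polymatroidal I -> single_degree (colon I 'X_[u]).
Proof.
move=> pI; have exI := polymatroidal_exchange pI; have [mI sI _] := pI.
have mIu := monomial_ideal_colon u mI.
have lift p : mingen (colon I 'X_[u]) p -> exists2 g, mingen I g & p = (g - u)%MM.
  move=> /(mingenP mIu)[]; rewrite colonX => /(mingen_below mI)[g Ig gle] min_p.
  exists g => //; apply/esym/min_p; last by rewrite lepm_BLR.
  rewrite colonX; apply: monomial_ideal_le (mingen_in mI Ig) => //.
  by rewrite -lepm_BLR lepm_refl.
have half p q : mingen (colon I 'X_[u]) p -> mingen (colon I 'X_[u]) q ->
    (mdeg p <= mdeg q)%N.
  move=> /[dup] /(mingenP mIu)[_ min_p] /lift[g Ig eq_p] /lift[h Ih eq_q].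
  rewrite leqNgt; apply/negP; rewrite eq_p eq_q => lt.
  have [g' Ig' [le ne]] := colon_degrees_drop sI exI Ig Ih lt.
  apply: ne; rewrite -eq_p; apply: min_p; last by rewrite eq_p.
  rewrite colonX; apply: monomial_ideal_le (mingen_in mI Ig') => //.
  by rewrite -lepm_BLR lepm_refl.
by move=> p q Ip Iq; apply/eqP; rewrite eqn_leq !half.
Qed.

(** The colon ideal by u / x_i has x_i as a generator, so all its generators
    are variables; one of them divides the image of v. *)
Lemma single_degree_colons_polymatroidal I : monomial_ideal I ->
  (forall u, single_degree (colon I 'X_[u])) -> polymatroidal I.
Proof.
move=> mI sIu.
have sI : single_degree I.
  have mI0 := monomial_ideal_colon 0%MM mI.
  have I0 m : mingen I m -> mingen (colon I 'X_[0]) m.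
    move=> /(mingenP mI)[Im min_m]; apply/(mingenP mI0).
    by split=> [|m']; rewrite colonX addm0 //; apply: min_m.
  by move=> u v /I0 Iu /I0 Iv; apply: (sIu 0%MM).
split=> // u v /(mingenP mI)[Iu min_u] /(mingen_in mI) Iv i vu.
have ui : (U_(i) <= u)%MM by rewrite lep1mP -lt0n (leq_trans _ vu).
set w := (u - U_(i))%MM.
have mIw := monomial_ideal_colon w mI.
have Iw_i : minimal_in (colon I 'X_[w]) U_(i).
  split=> [|m]; rewrite colonX; first by rewrite addmC submK.
  move=> Imw mi; apply: lepm_mdeg_eq => //; rewrite mdeg1 lt0n mdeg_eq0.
  apply/eqP => m0; move: Imw; rewrite m0 add0m => Iw.
  have /(congr1 (fun m => m i)) := min_u w Iw (lem_subr _ _).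
  by rewrite mnmBE mnm1E eqxx; lia.
have [|q Iq qle] := mingen_below mIw (m := (v - w)%MM).
  by rewrite colonX; apply: monomial_ideal_le Iv => //; rewrite -lepm_BLR lepm_refl.
have /mdeg1P[j /eqP eq_q] : mdeg q == 1%N.
  by apply/eqP; rewrite -(mdeg1 i); apply: (sIu w) => //; apply/mingenP.
move: qle; rewrite eq_q => /mnm_lepP/(_ j); rewrite mnm1E eqxx mnmBE subn_gt0 => wv.
exists j; last by rewrite addmC -colonX -eq_q; apply: mingen_in.
move: wv; rewrite mnmBE mnm1E; case: eqP => [<-|_]; lia.
Qed.

Lemma colon_colon I u v : same_set (colon (colon I 'X_[u]) 'X_[v]) (colon I 'X_[v + u]).
Proof. by move=> f; rewrite /colon mpolyXD mulrA. Qed.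

Lemma mingen_ext I L : monomial_ideal I -> same_set I L ->
  forall m, mingen I m <-> mingen L m.
Proof.
move=> mI IL m; have mL : monomial_ideal L.
  by have [A IA] := mI; exists A => f; rewrite -IL.
rewrite !mingenP // /minimal_in IL.
by split=> -[Lm min_m]; split=> // m' /IL; apply: min_m.
Qed.

Lemma single_degree_colons_colon I u : monomial_ideal I ->
  (forall v, single_degree (colon I 'X_[v])) ->
  forall v, single_degree (colon (colon I 'X_[u]) 'X_[v]).
Proof.
move=> mI sI v p q.
have mIuv := monomial_ideal_colon v (monomial_ideal_colon u mI).
by rewrite !(mingen_ext mIuv (colon_colon I u v)); apply: sI.
Qed.

(** No exchange has to be carried out in I : u, because its own colon ideals
    are colon ideals of I. *)
Lemma polymatroidal_colon I u : polymatroidal I -> polymatroidal (colon I 'X_[u]).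
Proof.
move=> pI; have [mI _ _] := pI.
apply: single_degree_colons_polymatroidal; first exact: monomial_ideal_colon.
by apply: single_degree_colons_colon => // v; apply: polymatroidal_colon_single_degree.
Qed.

End Polymatroidal.

(** * Reverse lexicographic linear quotients *)

Section Revlex.
Context {n : nat}.
Implicit Types (u v w : 'X_{1..n}).

Lemma revlex_gtP u v : mdeg u = mdeg v ->
  reflect (exists i : 'I_n, (u i < v i)%N /\ forall k : 'I_n, (i < k)%N -> u k = v k)
          (revlex_gt u v).
Proof.
move=> uv; rewrite /revlex_gt uv ltnn eqxx /=.
apply: (iffP existsP) => -[i].
  by move=> /andP[ui /forallP eq_uv]; exists i; split=> // k ik; apply/eqP/(implyP (eq_uv k)).
by move=> [ui eq_uv]; exists i; rewrite ui; apply/forallP => k; apply/implyP => /eq_uv->.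
Qed.

Lemma revlex_gt_irr : irreflexive (@revlex_gt n).
Proof. by move=> u; apply/(revlex_gtP erefl) => -[i []]; rewrite ltnn. Qed.

Lemma revlex_gt_mdeg u v : revlex_gt u v -> (mdeg v <= mdeg u)%N.
Proof. by case/orP => [/ltnW|/andP[/eqP->]]. Qed.

Lemma revlex_gt_trans : transitive (@revlex_gt n).
Proof.
move=> v u w uv vw; have := revlex_gt_mdeg uv; have := revlex_gt_mdeg vw.
have [wu _ _|neq] := boolP (mdeg w < mdeg u)%N; first by rewrite /revlex_gt wu.
move=> dwv dvu; have du : mdeg u = mdeg v by lia.
have dv : mdeg v = mdeg w by lia.
move: uv vw => /(revlex_gtP du)[i [ui eq_uv]] /(revlex_gtP dv)[j [vj eq_vw]].
apply/revlex_gtP; first by rewrite du.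
have [ij|ji|/ord_inj ij] := ltngtP i j.
- by exists j; rewrite eq_uv //; split=> // k jk; rewrite eq_uv ?eq_vw // (ltn_trans ij).
- by exists i; rewrite -eq_vw //; split=> // k ik; rewrite eq_uv ?eq_vw // (ltn_trans ji).
exists i; split; first by apply: ltn_trans ui _; rewrite ij.
by move=> k ik; rewrite eq_uv // eq_vw // -ij.
Qed.

Lemma revlex_gt_total u v : u != v -> revlex_gt u v || revlex_gt v u.
Proof.
move=> neq; have [lt|lt|deg] := ltngtP (mdeg u) (mdeg v).
- by rewrite /revlex_gt lt orbT.
- by rewrite /revlex_gt lt.
have [i0 ne_i0] : exists i, u i != v i.
  apply/existsP; apply: contraNT neq => /existsPn eq_uv.
  by apply/eqP/mnmP => i; apply/eqP; rewrite -[_ == _]negbK eq_uv.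
have [i ne_i max_i] := @arg_maxnP _ i0 (fun i => u i != v i) (@nat_of_ord n) ne_i0.
have eq_uv (k : 'I_n) : (i < k)%N -> u k = v k.
  by move=> ik; apply/eqP; apply: contraTT ik => /max_i; rewrite -leqNgt.
have [uv|] := boolP (u i < v i)%N.
  by apply/orP; left; apply/revlex_gtP => //; exists i.
rewrite -leqNgt leq_eqVlt eq_sym (negbTE ne_i) /= => vu.
by apply/orP; right; apply/revlex_gtP => //; exists i; split=> // k /eq_uv.
Qed.

Lemma revlex_sorted_enum (s : seq 'X_{1..n}) :
  exists2 t, t =i s & sorted revlex_gt t.
Proof.
pose ge u v := (u == v) || revlex_gt u v.
have ge_tot : total ge.
  move=> u v; rewrite /ge orbACA; have [//|/revlex_gt_total->] := eqVneq u v.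
  exact: orbT.
have ge_tr : transitive ge.
  move=> v u w; rewrite /ge => /predU1P[->//|uv] /predU1P[<-|vw].
    by rewrite uv orbT.
  by rewrite (revlex_gt_trans uv vw) orbT.
exists (sort ge (undup s)); first by move=> u; rewrite mem_sort mem_undup.
apply: pairwise_sorted.
have := sort_sorted ge_tot (undup s); rewrite (sorted_pairwise ge_tr) => ge_t.
have := undup_uniq s; rewrite -(sort_uniq ge) uniq_pairwise => ne_t.
have : pairwise [rel u v | ge u v && (u != v)] (sort ge (undup s)).
  by rewrite pairwise_relI ge_t ne_t.
by apply: sub_pairwise => u v /= /andP[/predU1P[->|//]]; rewrite eqxx.
Qed.

Lemma take_revlex (s : seq 'X_{1..n}) i u : sorted revlex_gt s -> (i < size s)%N ->
  (u \in take i s) = (u \in s) && revlex_gt u (nth 0%MM s i).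
Proof.
move=> + lt_i; rewrite (sorted_pairwise revlex_gt_trans).
rewrite -[in pairwise _ _](cat_take_drop i s) (drop_nth 0%MM lt_i).
rewrite pairwise_cat pairwise_cons => /and3P[/allrelP gt_take _ /andP[/allP gt_drop _]].
apply/idP/andP=> [ui|[]].
  by rewrite (mem_take ui) gt_take // mem_head.
rewrite -[in u \in s](cat_take_drop i s) (drop_nth 0%MM lt_i) mem_cat inE.
case/or3P => // [/eqP->|/gt_drop gt_u u_gt]; first by rewrite revlex_gt_irr.
by have := revlex_gt_trans gt_u u_gt; rewrite revlex_gt_irr.
Qed.

End Revlex.

Section RevlexLinearQuotients.
Context {K : fieldType} {n : nat}.
Local Notation S := {mpoly K[n]}.
Implicit Types (L : S -> Prop) (m u v g : 'X_{1..n}).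

(** An ideal generated by variables is the monomial ideal on exponent vectors
    of degree one. *)
Lemma variable_idealP (A : {set 'I_n}) (f : S) :
  ideal_gen (fun h => exists2 i, i \in A & h = 'X_i) f <->
  forall m, m \in msupp f -> exists2 i, i \in A & (0 < m i)%N.
Proof.
have -> : ideal_gen (fun h : S => exists2 i, i \in A & h = 'X_i) f <->
    mono_ideal (fun m => exists2 i, i \in A & m = U_(i)%MM) f.
  split=> If J idJ AJ; apply: If => // h.
    by case=> i iA ->; apply: AJ; exists U_(i)%MM => //; exists i.
  by case=> _ [i iA ->] ->; apply: AJ; exists i.
rewrite mono_idealP; split=> If m /If.
  by move=> [_ [i iA ->]]; rewrite lep1mP -lt0n; exists i.
by case=> i iA mi; exists U_(i)%MM; [exists i | rewrite lep1mP -lt0n].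
Qed.

(** There are finitely many monomials of any given degree. *)
Lemma mingen_enum L : single_degree L ->
  exists s : seq 'X_{1..n}, forall m, m \in s <-> mingen L m.
Proof.
move=> sL; have [[u Lu]|none] := classic (exists u, mingen L u); last first.
  by exists [::] => m; split=> // Lm; case: none; exists m.
pose inL m : bool := if excluded_middle_informative (mingen L m) then true else false.
have inLP m : inL m <-> mingen L m.
  by rewrite /inL; case: excluded_middle_informative.
exists [seq val b | b <- enum {: 'X_{1..n < (mdeg u).+1}} & inL (val b)] => m; split.
  by move=> /mapP[b]; rewrite mem_filter => /andP[/inLP Lb _] ->.
move=> Lm; have deg_m : (mdeg m < (mdeg u).+1)%N by rewrite (sL m u).
apply/mapP; exists (BMultinom deg_m) => //.
by rewrite mem_filter mem_enum andbT; apply/inLP.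
Qed.

(** The variables generating the colon ideal at u are the x_j such that x_j u
    is a multiple of an earlier generator.  Each earlier generator v provides
    one dividing v / gcd(v, u), by exchange at the last index where u and v
    differ. *)
Lemma polymatroidal_revlex_linear_quotients L :
  polymatroidal L -> revlex_linear_quotients L.
Proof.
move=> pL; have exL := polymatroidal_exchange pL; have [mL sL _] := pL.
have [s0 s0L] := mingen_enum sL; have [s s_s0 sort_s] := revlex_sorted_enum s0.
have sLP m : m \in s <-> mingen L m by rewrite s_s0.
exists s; split=> // i /andP[_ lt_i]; set u := nth _ _ _.
have Lu : mingen L u by apply/sLP; rewrite mem_nth.
exists [set j | has (fun m => (m <= U_(j) + u)%MM) (take i s)] => f.
rewrite variable_idealP /colon mono_idealP; split=> [If m fm|If _ /msupp_mulX[m fm ->]].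
  have [|v] := If (m + u)%MM; first by apply/msupp_mulX; exists m.
  rewrite take_revlex // => /andP[/sLP Lv v_gt_u] vmu.
  have /(revlex_gtP (sL v u Lv Lu))[l [vl eq_vu]] := v_gt_u.
  have [j uj Luj] := exL u v Lu Lv l vl.
  exists j; last by have /mnm_lepP/(_ j) := vmu; rewrite mnmDE; lia.
  (* u and v agree after l, and v is smaller than u at l. *)
  have jl : (j < l)%N.
    rewrite ltnNge; apply/negP; rewrite leq_eqVlt => /predU1P[/ord_inj lj|lj].
      by move: uj; rewrite -lj; lia.
    by move: uj; rewrite eq_vu // ltnn.
  rewrite inE; apply/hasP; exists (u - U_(l) + U_(j))%MM; last first.
    by apply/mnm_lepP => k; rewrite !(mnmDE, mnmBE) addnC leq_add2l leq_subr.
  rewrite take_revlex //; apply/andP; split; first exact/sLP.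
  apply/(revlex_gtP (sL _ _ Luj Lu)); exists l; split=> [|k lk].
    by rewrite mnmDE mnmBE !mnm1E eqxx -val_eqE /= (ltn_eqF jl); lia.
  rewrite mnmDE mnmBE !mnm1E -!val_eqE /= (ltn_eqF lk) (ltn_eqF (ltn_trans jl lk)).
  by rewrite subn0 addn0.
have [j] := If m fm; rewrite inE => /hasP[v vi vju] mj; exists v => //.
apply: lepm_trans vju _; apply/mnm_lepP => k; rewrite !mnmDE mnm1E.
by case: eqP => [<-|_]; lia.
Qed.

End RevlexLinearQuotients.

(** * Syzygies of matrices with linear quotients *)

Section LinearQuotientMatrices.
Context {K : fieldType} {n : nat}.
Local Notation S := {mpoly K[n]}.

Lemma pihomogMr d e (p q : S) : q \is d.-homog ->
  pihomog mdeg (e + d) (p * q) = pihomog mdeg e p * q.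
Proof.
move=> hq; have lt_e : (e < maxn (msize p) e.+1)%N by rewrite leq_max leqnn orbT.
rewrite {1}(pihomog_partitionE (leq_maxl (msize p) e.+1)).
rewrite mulr_suml raddf_sum (bigD1 (Ordinal lt_e)) //= pihomog_dE; last first.
  by apply: dhomogM => //; apply: pihomogP.
rewrite big1 ?addr0 // => b ne_be.
apply: (@pihomog_ne0 _ _ _ (b + d)%N); last by apply: dhomogM => //; apply: pihomogP.
by rewrite eqn_add2r.
Qed.

Definition homog_mx d m r (A : 'M[S]_(m, r)) := forall i j, A i j \is d.-homog.

(** Taking the component of degree e of the coefficients is what makes the
    syzygies below homogeneous. *)
Lemma mulmx_pihomog e d m r (v : 'rV[S]_m) (A : 'M[S]_(m, r)) : homog_mx d A ->
  map_mx (pihomog mdeg e) v *m A = map_mx (pihomog mdeg (e + d)) (v *m A).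
Proof.
move=> hA; apply/rowP => j; rewrite !mxE raddf_sum; apply: eq_bigr => l _.
by rewrite mxE; apply/esym/pihomogMr/hA.
Qed.

Definition variable_ideal (P : {set 'I_n}) : S -> Prop :=
  ideal_gen (fun h => exists2 x, x \in P & h = 'X_x).

Lemma variable_ideal_sum (P : {set 'I_n}) f : variable_ideal P f ->
  exists c : 'I_n -> S, f = \sum_(x in P) c x * 'X_x.
Proof.
move=> /(_ (fun f => exists c : 'I_n -> S, f = \sum_(x in P) c x * 'X_x)); apply.
  split=> [|_ _ [c ->] [c' ->]|g _ [c ->]].
  - by exists (fun=> 0); rewrite big1 // => x _; rewrite mul0r.
  - by exists (fun x => c x + c' x); rewrite -big_split; apply: eq_bigr => x _; rewrite mulrDl.
  by exists (fun x => g * c x); rewrite mulr_sumr; apply: eq_bigr => x _; rewrite mulrA.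
move=> _ [x Px ->]; exists (fun y => (y == x)%:R).
by rewrite (bigD1 x) //= eqxx mul1r big1 ?addr0 // => y /andP[_ /negbTE->]; rewrite mul0r.
Qed.

(** The submodule spanned by the rows of A that precede N.  The order of the
    rows is given by a rank function, as the syzygies will be indexed by an
    enumeration of pairs whose order is unrelated to the one needed. *)
Definition span_below m r (A : 'M[S]_(m, r)) (rk : 'I_m -> nat) N (v : 'rV[S]_r) :=
  exists2 w : 'rV[S]_m, (forall l, (N <= rk l)%N -> w 0 l = 0) & v = w *m A.

Section SpanBelow.
Context {m r : nat} (A : 'M[S]_(m, r)) (rk : 'I_m -> nat) (N : nat).

Lemma span_below0 : span_below A rk N 0.
Proof. by exists 0; rewrite ?mul0mx // => l _; rewrite mxE. Qed.

Lemma span_belowD u v :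
  span_below A rk N u -> span_below A rk N v -> span_below A rk N (u + v).
Proof.
move=> [w w0 ->] [w' w'0 ->]; exists (w + w'); rewrite ?mulmxDl // => l Nl.
by rewrite mxE w0 // w'0 // addr0.
Qed.

Lemma span_belowZ f v : span_below A rk N v -> span_below A rk N (f *: v).
Proof.
move=> [w w0 ->]; exists (f *: w); rewrite ?scalemxAl // => l Nl.
by rewrite mxE w0 // mulr0.
Qed.

Lemma span_below_sum (T : Type) (s : seq T) (Q : pred T) (F : T -> 'rV_r) :
  (forall t, Q t -> span_below A rk N (F t)) ->
  span_below A rk N (\sum_(t <- s | Q t) F t).
Proof.
by move=> FN; elim/big_rec: _ => [|t v /FN]; [exact: span_below0 | exact: span_belowD].
Qed.

Lemma span_below_row t : (rk t < N)%N -> span_below A rk N (row t A).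
Proof.
move=> tN; exists (delta_mx 0 t); last by rewrite rowE.
by move=> l Nl; rewrite mxE eqxx; case: eqP => // lt; rewrite -lt ltnNge Nl in tN.
Qed.

Lemma span_below_widen M v : (N <= M)%N ->
  span_below A rk N v -> span_below A rk M v.
Proof. by move=> NM [w w0 ->]; exists w => // l Ml; apply: w0; apply: leq_trans Ml. Qed.

End SpanBelow.

(** The analogue for modules of linear quotients of an ideal: the rows of A are
    totally ordered and the colon of each row with respect to the preceding
    ones is generated by variables. *)
Definition has_linear_quotients m r (A : 'M[S]_(m, r)) :=
  exists (rk : 'I_m -> nat) (P : 'I_m -> {set 'I_n}), injective rk /\
  forall k f, span_below A rk (rk k) (f *: row k A) <-> variable_ideal (P k) f.

Section Syzygies.
Context {m r : nat} (A : 'M[S]_(m, r)) (rk : 'I_m -> nat) (P : 'I_m -> {set 'I_n}).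
Hypothesis rk_inj : injective rk.
Hypothesis colonA : forall k f,
  span_below A rk (rk k) (f *: row k A) <-> variable_ideal (P k) f.

(* c (k, x) holds the coefficients that express x times row k by the preceding
   rows. *)
Variable c : 'I_m * 'I_n -> 'rV[S]_m.
Hypothesis c_below : forall k x l, x \in P k -> (rk k <= rk l)%N -> c (k, x) 0 l = 0.
Hypothesis c_row : forall k x, x \in P k -> 'X_x *: row k A = c (k, x) *m A.

Definition syzygy k x : 'rV[S]_m := 'X_x *: delta_mx 0 k - c (k, x).

Definition syzygy_index : {set 'I_m * 'I_n} := [set p | p.2 \in P p.1].

Definition syzygy_mx : 'M[S]_(#|syzygy_index|, m) :=
  \matrix_t syzygy (enum_val t).1 (enum_val t).2.

(** The lexicographic order on pairs (k, x), as x < n. *)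
Definition syzygy_rank (t : 'I_#|syzygy_index|) : nat :=
  (rk (enum_val t).1 * n + (enum_val t).2)%N.

Lemma syzygy_mxE t : row t syzygy_mx = syzygy (enum_val t).1 (enum_val t).2.
Proof. by rewrite rowK. Qed.

Lemma syzygyE k x l : syzygy k x 0 l = 'X_x *+ (l == k) - c (k, x) 0 l.
Proof. by rewrite !mxE eqxx /= mulr_natr. Qed.

Lemma syzygy_top k x l : x \in P k -> (rk k <= rk l)%N ->
  syzygy k x 0 l = 'X_x *+ (l == k).
Proof. by move=> Px kl; rewrite syzygyE c_below // subr0. Qed.

Lemma syzygy_kernel k x : x \in P k -> syzygy k x *m A = 0.
Proof. by move=> Px; rewrite mulmxBl -scalemxAl -rowE c_row // subrr. Qed.

Lemma enum_val_syzygy (t : 'I_#|syzygy_index|) : (enum_val t).2 \in P (enum_val t).1.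
Proof. by have := enum_valP t; rewrite inE. Qed.

Lemma span_below_syzygy k x N : x \in P k -> (rk k * n + x < N)%N ->
  span_below syzygy_mx syzygy_rank N (syzygy k x).
Proof.
move=> Px kxN; have in_idx : (k, x) \in syzygy_index by rewrite inE.
have := @span_below_row _ _ syzygy_mx syzygy_rank N (enum_rank_in in_idx (k, x)).
by rewrite syzygy_mxE /syzygy_rank enum_rankK_in //=; apply.
Qed.

(** The coefficient of a relation at its last row k lies in the colon ideal of
    row k, so it is a combination of the variables in P_k; subtracting the same
    combination of the syzygies (k, x) gives a relation that ends earlier. *)
Lemma kernel_span_below N (v : 'rV[S]_m) : (forall l, (N <= rk l)%N -> v 0 l = 0) ->
  v *m A = 0 -> span_below syzygy_mx syzygy_rank (N * n) v.
Proof.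
elim: N v => [|N IH] v v0 vA.
  suff -> : v = 0 by exact: span_below0.
  by apply/rowP => l; rewrite mxE v0.
have [/existsP[k /eqP rk_k]|/existsPn rkN] := boolP [exists k, rk k == N]; last first.
  apply: (@span_below_widen _ _ _ _ (N * n)); first by rewrite leq_mul2r leqnSn orbT.
  by apply: IH => // l; rewrite leq_eqVlt eq_sym (negbTE (rkN l)) => /v0.
have /colonA/variable_ideal_sum[f eq_f] : span_below A rk (rk k) (v 0 k *: row k A).
  exists (v 0 k *: delta_mx 0 k - v); last by rewrite mulmxBl vA subr0 -scalemxAl -rowE.
  move=> l; rewrite rk_k leq_eqVlt !mxE eqxx /= => /predU1P[Nl|Nl].
    by have -> : l = k; [apply: rk_inj; rewrite rk_k | rewrite eqxx mulr1 subrr].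
  have /negbTE-> : l != k by apply: contraTneq Nl => ->; rewrite rk_k ltnn.
  by rewrite mulr0 v0 // subrr.
pose u := \sum_(x in P k) f x *: syzygy k x.
rewrite -(subrK u v); apply: span_belowD; last first.
  apply: span_below_sum => x Px; apply/span_belowZ/span_below_syzygy => //.
  by rewrite rk_k mulSnr ltn_add2l.
apply: (@span_below_widen _ _ _ _ (N * n)); first by rewrite leq_mul2r leqnSn orbT.
apply: IH => [l Nl|]; last first.
  rewrite mulmxBl vA mulmx_suml big1 ?subrr // => x Px.
  by rewrite -scalemxAl syzygy_kernel // scaler0.
have u_l : u 0 l = (\sum_(x in P k) f x * 'X_x) *+ (l == k).
  rewrite summxE -sumrMnl; apply: eq_bigr => x Px.
  by rewrite mxE syzygy_top ?rk_k // mulrnAr.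
rewrite 2!mxE u_l; case: eqP => [->|ne_lk]; first by rewrite -eq_f subrr.
rewrite subr0 v0 // ltn_neqAle Nl andbT -rk_k.
by apply/eqP => /rk_inj/esym.
Qed.

(** All relations lie below some rank, so [kernel_span_below] applies to them. *)
Lemma syzygy_mx_exact (v : 'rV[S]_m) :
  v *m A = 0 <-> exists w, v = w *m syzygy_mx.
Proof.
split=> [vA|[w ->]]; last first.
  rewrite -mulmxA; suff -> : syzygy_mx *m A = 0 by rewrite mulmx0.
  by apply/row_matrixP => t; rewrite row_mul syzygy_mxE row0 syzygy_kernel // enum_val_syzygy.
have [|//|w _ ->] := @kernel_span_below (\max_l rk l).+1 v; last by exists w.
by move=> l; rewrite ltnNge (leq_bigmax l).
Qed.

Lemma syzygy_rank_inj : injective syzygy_rank.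
Proof.
move=> t t'; rewrite /syzygy_rank => eq_rk; apply: enum_val_inj; move: eq_rk.
case: (enum_val t) (enum_val t') => [k x] [k' x'] /= eq_rk.
have n_gt0 : (0 < n)%N by apply: leq_ltn_trans (ltn_ord x).
have /rk_inj-> : rk k = rk k'.
  by have := congr1 (divn^~ n) eq_rk; rewrite !divnMDl // !divn_small // !addn0.
congr pair; apply: val_inj.
by have := congr1 (modn^~ n) eq_rk; rewrite !modnMDl !modn_small.
Qed.

(** The colon ideal of the syzygy (k, x) is generated by the y < x in P_k.  It
    contains them, because y (k, x) - x (k, y) is a relation between rows
    before k, hence a combination of earlier syzygies.  Conversely, if f (k, x)
    is a combination of earlier syzygies, comparing the coordinates at k shows
    that f x lies in the ideal of those y, and so does f, since x is not one
    of them. *)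
Lemma syzygy_mx_linear_quotients : has_linear_quotients syzygy_mx.
Proof.
exists syzygy_rank, (fun t : 'I_#|syzygy_index| =>
  [set x in P (enum_val t).1 | (x < (enum_val t).2)%N]).
split=> [|t f]; first exact: syzygy_rank_inj.
rewrite syzygy_mxE.
have -> : syzygy_rank t = (rk (enum_val t).1 * n + (enum_val t).2)%N by [].
have := enum_val_syzygy t.
case: (enum_val t) => [k x] /= Px; split=> [[w w0 eq_w]|]; last first.
  move/variable_ideal_sum=> [g ->]; rewrite scaler_suml.
  apply: span_below_sum => y; rewrite inE => /andP[Py yx].
  rewrite -scalerA; apply: span_belowZ.
  rewrite -(subrK ('X_x *: syzygy k y) ('X_y *: syzygy k x)); apply: span_belowD; last first.
    by apply/span_belowZ/span_below_syzygy; rewrite // ltn_add2l.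
  apply: (@span_below_widen _ _ _ _ (rk k * n)); first exact: leq_addr.
  apply: kernel_span_below => [l kl|]; last first.
    by rewrite mulmxBl -!scalemxAl !syzygy_kernel // !scaler0 subrr.
  have entry (v v' : 'rV[S]_m) : ('X_y *: v - 'X_x *: v') 0 l = 'X_y * v 0 l - 'X_x * v' 0 l.
    by rewrite !mxE.
  by rewrite entry !syzygy_top // !mulrnAr mulrC subrr.
set Q := [set y in P k | (y < x)%N].
(* Coordinate k of an earlier syzygy (k', x') is x' if k' = k, which forces
   x' < x, and is 0 otherwise. *)
have : variable_ideal Q (f * 'X_x).
  have -> : f * 'X_x = \sum_s w 0 s * syzygy_mx s k.
    have /(congr1 (fun v : 'rV_m => v 0 k)) := eq_w.
    by rewrite [in RHS]mxE mxE syzygy_top // eqxx.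
  apply: ideal_sum => [|s _]; first exact: ideal_gen_ideal.
  have [Q0 _ QM] := ideal_gen_ideal (fun h : S => exists2 x, x \in Q & h = 'X_x).
  have [lt_s|] := ltnP (syzygy_rank s) (rk k * n + x); last by move/w0->; rewrite mul0r.
  apply: QM; have -> : syzygy_mx s k = row s syzygy_mx 0 k by rewrite [RHS]mxE.
  rewrite syzygy_mxE; have := enum_val_syzygy s; move: lt_s; rewrite /syzygy_rank.
  case: (enum_val s) => [k' x'] /= lt_s Px'.
  have le_k : (rk k' <= rk k)%N by have := ltn_ord x; nia.
  rewrite syzygy_top //; case: eqP => [eq_k|_]; last exact: Q0.
  move=> J idJ; apply; exists x' => //; rewrite inE eq_k Px' /=.
  by move: lt_s; rewrite eq_k ltn_add2l.
move=> /variable_idealP fX; apply/variable_idealP => a fa.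
have [|y] := fX (a + U_(x))%MM; first by apply/msupp_mulX; exists a.
rewrite mnmDE mnm1E => Qy a_y; exists y => //; move: a_y Qy.
by case: eqP => [<-|_]; rewrite ?addn0 // inE ltnn andbF.
Qed.

End Syzygies.

(** The coefficients of the syzygies are replaced by their components of degree
    one; x times a row is homogeneous of degree d + 1, so they express it just
    as well. *)
Lemma linear_syzygies d m r (A : 'M[S]_(m, r)) :
  homog_mx d A -> has_linear_quotients A ->
  exists B : {p & 'M[S]_(p, m)},
  [/\ homog_mx 1 (projT2 B), has_linear_quotients (projT2 B)
    & forall v : 'rV_m, v *m A = 0 <-> exists w, v = w *m projT2 B].
Proof.
move=> hA [rk [P [rk_inj colonA]]].
have /fin_all_exists[c cP] : forall p : 'I_m * 'I_n, exists c : 'rV[S]_m,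
    p.2 \in P p.1 -> [/\ forall l, (rk p.1 <= rk l)%N -> c 0 l = 0,
      'X_p.2 *: row p.1 A = c *m A & homog_mx 1 c].
  case=> k x /=; have [Px|] := boolP (x \in P k); last by exists 0.
  have [|w w0 eq_w] := (colonA k 'X_x).2; first by move=> J _; apply; exists x.
  exists (map_mx (pihomog mdeg 1) w) => _; split=> [l kl||i j].
  - by rewrite mxE w0 // pihomog0.
  - rewrite (mulmx_pihomog _ _ hA) -eq_w; apply/rowP => j.
    by rewrite !mxE pihomog_dE //; apply: dhomogM (hA k j); rewrite dhomogX; apply/eqP/mdeg1.
  by rewrite mxE; apply: pihomogP.
have c_below k x l : x \in P k -> (rk k <= rk l)%N -> c (k, x) 0 l = 0.
  by move=> Px; have [c0 _ _] := cP (k, x) Px; apply: c0.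
have c_row k x : x \in P k -> 'X_x *: row k A = c (k, x) *m A.
  by move=> Px; have [] := cP (k, x) Px.
exists (existT (fun p => 'M[S]_(p, m)) _ (syzygy_mx P c)); split=> /=.
- move=> t l; rewrite mxE syzygyE; have := enum_val_syzygy t.
  case: (enum_val t) => k x /= Px; have [_ _ hc] := cP (k, x) Px.
  by apply: rpredB => //; apply: rpredMn; rewrite dhomogX; apply/eqP/mdeg1.
- exact: (syzygy_mx_linear_quotients rk_inj colonA (c := c) c_below c_row).
exact: (syzygy_mx_exact rk_inj colonA (c := c) c_below c_row).
Qed.

End LinearQuotientMatrices.

(** * Linear resolutions *)

Section LinearResolution.
Context {K : fieldType} {n : nat}.
Local Notation S := {mpoly K[n]}.
Implicit Types (L : S -> Prop) (s : seq 'X_{1..n}).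

(** Bundles what [linear_syzygies] consumes and produces, so that passing to
    syzygies can be iterated. *)
Record lq_matrix := LQMatrix {
  lq_rows : nat;
  lq_cols : nat;
  lq_degree : nat;
  lq_mx : 'M[S]_(lq_rows, lq_cols);
  lq_homog : homog_mx lq_degree lq_mx;
  lq_quotients : has_linear_quotients lq_mx
}.

Definition lq_syzygies (A : lq_matrix) : {p & 'M[S]_(p, lq_rows A)} :=
  sval (constructive_indefinite_description _
    (linear_syzygies (@lq_homog A) (lq_quotients A))).

Lemma lq_syzygiesP (A : lq_matrix) :
  [/\ homog_mx 1 (projT2 (lq_syzygies A)),
      has_linear_quotients (projT2 (lq_syzygies A))
    & forall v : 'rV_(lq_rows A),
      v *m lq_mx A = 0 <-> exists w, v = w *m projT2 (lq_syzygies A)].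
Proof. by rewrite /lq_syzygies; case: constructive_indefinite_description. Qed.

Definition lq_next (A : lq_matrix) : lq_matrix :=
  LQMatrix (let: And3 homogB _ _ := lq_syzygiesP A in homogB)
           (let: And3 _ quotientsB _ := lq_syzygiesP A in quotientsB).

Definition lq_resolution d m (A : 'cV[S]_m) (homogA : homog_mx d A)
    (quotientsA : has_linear_quotients A) : free_complex (K := K) (n := n) :=
  let stage i := iter i lq_next (LQMatrix homogA quotientsA) in
  @FreeComplex K n (fun i => lq_rows (stage i)) (fun i _ => (i + d)%N)
    (fun i => lq_mx (stage i.+1)) A.

(** In the resolution obtained by iterating [linear_syzygies], the module in
    homological degree i is generated in degree i + d, so there is nothing in
    the other degrees of its reduction modulo the variables. *)
Lemma linear_quotients_linear_resolution L d m (A : 'cV[S]_m) :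
  homog_mx d A -> has_linear_quotients A ->
  (forall f, L f <-> exists v : 'rV_m, v *m A = f%:M) ->
  has_linear_resolution L.
Proof.
move=> hA qA LA; exists d => i j ne_j; exists (lq_resolution hA qA).
  split=> //.
  - split=> [k|l k k' a /=]; first exact: hA.
    set B := iter l _ _; have [hB _ _] := lq_syzygiesP B.
    by have /dhomogP hBk := hB k k'; move=> /hBk /= ->; rewrite add1n addSn.
  - move=> v; pose B := LQMatrix hA qA.
    by have [_ _ exB] := lq_syzygiesP B; apply: exB.
  move=> l v; pose B := iter l.+1 lq_next (LQMatrix hA qA).
  by have [_ _ exB] := lq_syzygiesP B; apply: exB.
move=> v v_j _; exists 0 => [k|]; first by rewrite mxE eqxx.
rewrite mul0mx; apply/rowP => k; rewrite mxE; apply/eqP/negPn/negP => /v_j.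
exact/nesym.
Qed.

Definition monomial_col s : 'cV[S]_(size s) := \col_(k < size s) 'X_[nth 0%MM s k].

(** Links the colon ideals of a list of monomials to those of the rows of the
    column that they form. *)
Lemma span_below_monomial_col s N f :
  span_below (monomial_col s) (@nat_of_ord _) N f%:M <->
  mono_ideal (fun m => m \in take N s) f.
Proof.
have colE w : w *m monomial_col s = (\sum_k w 0 k * 'X_[nth 0%MM s k])%:M.
  by apply/rowP => j; rewrite ord1 !mxE eqxx mulr1n; apply: eq_bigr => k _; rewrite mxE.
have idJ : is_ideal (fun h => span_below (monomial_col s) (@nat_of_ord _) N h%:M).
  split=> [|g h|g h]; first by rewrite raddf0; apply: span_below0.
    by rewrite raddfD; apply: span_belowD.
  by rewrite scalar_mxM mul_scalar_mx; apply: span_belowZ.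
split=> [[w w0]|/(_ _ idJ)]; last first.
  apply=> _ [m m_s ->].
  have m_s' := mem_take m_s.
  have lt_m : (index m s < size s)%N by rewrite index_mem.
  have -> : ('X_[m])%:M = row (Ordinal lt_m) (monomial_col s).
    by apply/rowP => j; rewrite ord1 !mxE eqxx mulr1n /= nth_index.
  by apply: span_below_row; rewrite /= -in_take.
rewrite colE => /(congr1 (fun A : 'M_1 => A 0 0)); rewrite !mxE eqxx !mulr1n => ->.
apply: ideal_sum => [|k _]; first exact: ideal_gen_ideal.
have [J0 _ JM] := ideal_gen_ideal (fun f : S => exists2 m, m \in take N s & f = 'X_[m]).
have [kN|/w0->] := ltnP k N; last by rewrite mul0r; exact: J0.
apply: JM => J _; apply; exists (nth 0%MM s k) => //.
by rewrite -(nth_take 0%MM kN) mem_nth // size_take_min leq_min kN ltn_ord.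
Qed.

Lemma monomial_col_linear_quotients s : linear_quotients_wrt (K := K) s ->
  has_linear_quotients (monomial_col s).
Proof.
move=> lqs.
have /fin_all_exists[P PE] : forall k : 'I_(size s), exists P : {set 'I_n},
    same_set (colon (mono_ideal (fun m => m \in take k s)) 'X_[nth 0%MM s k])
      (variable_ideal (K := K) P).
  (* At the first generator the colon of the zero ideal is zero, which is
     generated by the empty set of variables. *)
  move=> k; have [k0|k_gt0] := posnP k; last by apply: lqs; rewrite k_gt0 ltn_ord.
  exists set0 => f; rewrite /variable_ideal variable_idealP /colon mono_idealP k0 take0.
  split=> [f0 m fm|f0 _ /msupp_mulX[m fm ->]]; last by have [x] := f0 m fm; rewrite inE.
  by have [|//] := f0 (m + nth 0%MM s k)%MM; apply/msupp_mulX; exists m; rewrite // k0.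
exists (@nat_of_ord _), P; split=> [|k f]; first exact: ord_inj.
have -> : f *: row k (monomial_col s) = (f * 'X_[nth 0%MM s k])%:M.
  by apply/rowP => j; rewrite ord1 !mxE eqxx mulr1n.
by rewrite span_below_monomial_col; apply: PE.
Qed.

Lemma revlex_linear_quotients_linear_resolution L :
  monomial_ideal L -> single_degree L -> revlex_linear_quotients L ->
  has_linear_resolution L.
Proof.
move=> mL sL [s [sLP _ lqs]].
have [d degs] : exists d, forall m, m \in s -> mdeg m = d.
  case: s sLP {lqs} => [|u s] sLP; first by exists 0%N.
  exists (mdeg u) => m /sLP Lm; apply: sL => //.
  by apply/sLP; rewrite mem_head.
apply: (@linear_quotients_linear_resolution _ d _ (monomial_col s)).
- by move=> i j; rewrite mxE dhomogX; apply/eqP/degs/mem_nth.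
- exact: monomial_col_linear_quotients.
move=> f; have -> : L f <-> mono_ideal (fun m => m \in take (size s) s) f.
  rewrite take_size (monomial_idealP mL) mono_idealP; split=> Lf m fm.
    by have [g /sLP] := mingen_below mL (Lf m fm); exists g.
  have [g gs gm] := Lf m fm; apply: monomial_ideal_le gm _ => //.
  by apply: mingen_in mL _; apply/sLP.
rewrite -span_below_monomial_col; split=> [[w _ ->]|[w <-]]; exists w => // l.
by rewrite leqNgt ltn_ord.
Qed.

(** Suppose that a generator u has a degree where Tor_0 vanishes, and write it
    as v times the augmentation.  The constant terms of v in degree mdeg u form
    a cycle in F_0 (x) K, hence a boundary, and lifting the boundary to F_1
    changes v by a relation into a vector without such constant terms.  Then
    the monomial u is a proper multiple of a monomial in L, by homogeneity,
    against its minimality. *)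
Lemma linear_resolution_single_degree L :
  monomial_ideal L -> has_linear_resolution L -> single_degree L.
Proof.
move=> mL [d torL]; suff deg_d u : mingen L u -> mdeg u = d.
  by move=> u v /deg_d-> /deg_d->.
move=> /(mingenP mL)[Lu min_u]; apply/eqP/negPn/negP => /eqP ne_d.
have [|F [[hF _] LF exF _] H0] := torL 0%N (mdeg u); first by rewrite add0n.
have [v vF] := (LF _).1 Lu.
pose v0 := \row_k (if fc_deg F 0 k == mdeg u then (v 0 k)@_0%MM else 0).
have [|//|w _ eq_w] := H0 v0.
  by move=> k; rewrite mxE; case: (fc_deg F 0 k =P _) => // _; rewrite eqxx.
pose z := map_mx (mpolyC n (R := K)) w *m fc_diff F 0.
have zF : z *m fc_aug F = 0 by apply/exF; exists (map_mx (mpolyC n (R := K)) w).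
have z0 k : (z 0 k)@_0%MM = v0 0 k.
  rewrite eq_w !mxE raddf_sum; apply: eq_bigr => l _ /=.
  by rewrite !mxE mcoeffCM.
have : u \in msupp (\sum_k (v - z) 0 k * fc_aug F k 0).
  have /(congr1 (fun A : 'M_1 => A 0 0)) : (v - z) *m fc_aug F = 'X_[u]%:M.
    by rewrite mulmxBl vF zF subr0.
  by rewrite !mxE eqxx mulr1n => ->; rewrite msuppX mem_head.
move=> /msupp_sum_le/flattenP[_ /mapP[k _ ->]].
move=> /msuppM_le/allpairsP[[a b] /= [vz_a aug_b eq_u]].
have Lb : L 'X_[b].
  apply: (monomial_idealP mL _).1 aug_b; apply/LF; exists (delta_mx 0 k).
  by rewrite -rowE; apply/rowP => j; rewrite !ord1 !mxE eqxx mulr1n.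
have eq_bu : b = u by apply: min_u => //; rewrite eq_u lem_addl.
have a0 : a = 0%MM by apply: (@addIm _ u); rewrite add0m -[in LHS]eq_bu.
have deg_k : fc_deg F 0 k = mdeg u.
  by have /dhomogP hFk := hF k; rewrite -eq_bu (hFk b).
move: vz_a; rewrite a0 mcoeff_msupp 2!mxE mcoeffB z0 mxE deg_k eqxx subrr.
by rewrite eqxx.
Qed.

End LinearResolution.

(** * The equivalence *)

Theorem theorem1p1 (K : fieldType) (n : nat) (I : {mpoly K[n]} -> Prop)
    (hI : monomial_ideal I) :
  [<-> polymatroidal I;
       forall u : 'X_{1..n}, polymatroidal (colon I 'X_[u]);
       forall u : 'X_{1..n},
         single_degree (colon I 'X_[u]) /\
         revlex_linear_quotients (colon I 'X_[u]);
       forall u : 'X_{1..n}, has_linear_resolution (colon I 'X_[u]);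
       forall u : 'X_{1..n}, single_degree (colon I 'X_[u])].
Proof.
tfae=> [pI u|pIu u|lqI u|lrI u|sI].
- exact: polymatroidal_colon.
- split; first by have [] := pIu u.
  exact: polymatroidal_revlex_linear_quotients.
- have [sIu lqIu] := lqI u.
  exact: revlex_linear_quotients_linear_resolution (monomial_ideal_colon u hI) sIu lqIu.
- exact: linear_resolution_single_degree (monomial_ideal_colon u hI) (lrI u).
exact: single_degree_colons_polymatroidal.
Qed.
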